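(* Let $G:\mathbb{D}\to\mathbb{C}$ be a holomorphic function. The following are equivalent: (1) $G$ is the infinitesimal generator of a semigroup of linear fractional self-maps of $\mathbb{D}$. (2) $G$ is a polynomial of degree at most two and $\mathrm{Re}(G(z)\overline z)\le0$ for all $z\in\partial\mathbb{D}$. (3) $G$ is a polynomial of the form $G(z)=\alpha z^2+\beta z+\gamma$ with $\mathrm{Re}(\beta)+|\alpha+\overline\gamma|\le0$. (4) $G$ is a polynomial of the form $G(z)=a-\overline a z^2-z(mz+n)$, $z\in\mathbb{D}$, with $a,m,n\in\mathbb{C}$ and $\mathrm{Re}(n)\ge|m|$. (5) $G$ is the infinitesimal generator of a semigroup of holomorphic self-maps of $\mathbb{D}$ and it is a polynomial of degree at most two. Moreover, when these hold, the following are equivalent: $\mathrm{Re}(n)=m=0$ in (4); $\mathrm{Re}(\beta)=|\alpha+\overline\gamma|=0$ in (3); equality holds for all $z\in\partial\mathbb{D}$ in (2); $G$ is the infinitesimal generator of a semigroup of automorphisms of $\mathbb{D}$.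
   Context: $\mathbb{D}$ is the open unit disc in $\mathbb{C}$. A (continuous) semigroup in $\mathbb{D}$ is a family $(\varphi_t)_{t\ge0}$ of holomorphic maps $\varphi_t:\mathbb{D}\to\mathbb{D}$ with $\varphi_0=\mathrm{id}$, $\varphi_{t+s}=\varphi_t\circ\varphi_s$, and $\varphi_t\to\mathrm{id}$ uniformly on compacta as $t\to0^+$. Its infinitesimal generator is the unique holomorphic $G:\mathbb{D}\to\mathbb{C}$ with $\frac{\partial\varphi_t(z)}{\partial t}=G(\varphi_t(z))$, i.e. $G(z)=\lim_{t\to0^+}(\varphi_t(z)-z)/t$. It is a semigroup of linear fractional self-maps if every $\varphi_t$ is a linear fractional self-map of $\mathbb{D}$, i.e. a non-constant map of the form $z\mapsto\frac{az+b}{cz+d}$, with $|d|>|c|$, mapping $\mathbb{D}$ into $\mathbb{D}$; it is a semigroup of automorphisms if every $\varphi_t$ is a holomorphic automorphism of $\mathbb{D}$. The zero polynomial counts as a polynomial of degree at most two (and generates the trivial semigroup). *)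

(* Defs.v *)
From HB Require Import structures.
From mathcomp Require Import all_boot all_order all_algebra.
From mathcomp Require Import all_classical all_reals all_analysis.
From mathcomp Require Export complex.
Import Order.TTheory GRing.Theory Num.Theory.
Import numFieldNormedType.Exports.
Set Implicit Arguments.
Unset Strict Implicit.
Unset Printing Implicit Defensive.
Local Open Scope classical_set_scope.
Local Open Scope ring_scope.

(* `R[i]^o` is R[i] seen as a normed module over itself, so that `derivable`
   below is complex differentiability.  The norm and 'Re take their (real)
   values in R[i], and x <= y in R[i] entails that y - x is real. *)

Section Semigroups.
Variable R : realType.
Local Notation C := (R[i]^o).
Implicit Types (f G : C -> C) (phi : R -> C -> C).

Definition unit_disc : set C := [set z | `|z| < 1].

Definition unit_circle : set C := [set z | `|z| = 1].

(* Maps defined on the disc are represented by total functions on C whose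
   values outside the disc are irrelevant. *)
Definition holomorphic_on_disc f : Prop :=
  forall z, unit_disc z -> derivable f z 1.

Definition holomorphic_self_map f : Prop :=
  holomorphic_on_disc f /\ set_fun unit_disc unit_disc f.

Definition linear_fractional_self_map f : Prop :=
  [/\ exists a b c d : C, `|c| < `|d| /\
        forall z, unit_disc z -> f z = (a * z + b) / (c * z + d),
      ~ (exists w, forall z, unit_disc z -> f z = w) &
      set_fun unit_disc unit_disc f].

Definition automorphism f : Prop :=
  holomorphic_self_map f /\
  exists2 g, holomorphic_self_map g &
    forall z, unit_disc z -> g (f z) = z /\ f (g z) = z.

(* Only the values phi t with t >= 0 are relevant. *)
Definition semigroup phi : Prop :=
  [/\ forall t : R, 0 <= t -> holomorphic_self_map (phi t),
      forall z, unit_disc z -> phi 0 z = z,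
      forall (t s : R) (z : C), 0 <= t -> 0 <= s -> unit_disc z ->
        phi (t + s) z = phi t (phi s z) &
      {family compactly_in unit_disc, phi t @[t --> 0^'+] --> (id : C -> C)}].

(* The t-derivative is taken in [0, +oo[, hence is one-sided at t = 0. *)
Definition generator_of phi G : Prop :=
  holomorphic_on_disc G /\
  forall (z : C) (t : R), unit_disc z -> 0 <= t ->
    (phi (t + h) z - phi t z) / h%:C%C
      @[h --> within [set h | 0 <= t + h] (0 : R)^'] --> (G (phi t z) : C).

Definition generates_semigroup G : Prop :=
  exists2 phi, semigroup phi & generator_of phi G.

Definition generates_lft_semigroup G : Prop :=
  exists phi, [/\ semigroup phi,
    forall t : R, 0 <= t -> linear_fractional_self_map (phi t) &
    generator_of phi G].

Definition generates_automorphism_semigroup G : Prop :=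
  exists phi, [/\ semigroup phi,
    forall t : R, 0 <= t -> automorphism (phi t) &
    generator_of phi G].

(* size p <= 3 is "degree at most two", the zero polynomial included. *)
Definition is_poly2 G (p : {poly R[i]}) : Prop :=
  (size p <= 3)%N /\ forall z, unit_disc z -> G z = p.[z].

Definition boundary_form G (p : {poly R[i]}) : Prop :=
  is_poly2 G p /\ forall z, unit_circle z -> 'Re (p.[z] * z^* ) <= 0.

Definition coef_form G (alpha beta gamma : R[i]) : Prop :=
  (forall z, unit_disc z -> G z = alpha * z ^+ 2 + beta * z + gamma) /\
  'Re beta + `|alpha + gamma^* | <= 0.

Definition amn_form G (a m n : R[i]) : Prop :=
  (forall z, unit_disc z -> G z = a - a^* * z ^+ 2 - z * (m * z + n)) /\
  `|m| <= 'Re n.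

End Semigroups.

(* Main.v *)
Require Import Defs.
From HB Require Import structures.
From mathcomp Require Import all_boot all_order all_algebra.
From mathcomp Require Import all_classical all_reals all_analysis.
From mathcomp Require Import complex ring.
Import Order.TTheory GRing.Theory Num.Theory.
Import numFieldNormedType.Exports.
Set Implicit Arguments.
Unset Strict Implicit.
Unset Printing Implicit Defensive.
Local Open Scope classical_set_scope.
Local Open Scope ring_scope.

(** The theorem is a statement about the Riccati equation
    x' = alpha x^2 + beta x + gamma, and everything is read off its explicit
    solution.

    A quadratic vector field is the projection of a linear one.  With
    M = [[beta/2, gamma], [-alpha, -beta/2]] and (n, d) = exp(tM) (x, y), the
    ratio n/d solves the Riccati equation.  As M has trace zero, M^2 is a
    scalar, and exp(tM) = cosh(mt) + (sinh(mt)/m) M with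
    m^2 = (beta/2)^2 - alpha gamma; this is [flow_num], [flow_den], [flow].
    The derivative of the Hermitian form |n|^2 - |d|^2 along exp(tM) is
    Re beta (|n|^2 + |d|^2) + 2 Re((alpha + conj gamma) n conj d)
    ([Re_energy_rate]), and on the unit circle Re(G(z) conj z) is
    Re beta + Re((alpha + conj gamma) z) ([boundary_Re]).  Rotating z, the
    latter is nonpositive on the circle iff
    Re beta + |alpha + conj gamma| <= 0 ([Re_circle_le0]), which in turn makes
    the former nonpositive everywhere ([Re_energy_rate_le0]).

    Sufficiency: if the form decreases, then |n| < |d| persists, hence the flow
    maps the disc into itself and is a semigroup generated by G
    ([flow_semigroup], [flow_generator]).

    Necessity: let a semigroup phi be generated by a quadratic G.  By
    uniqueness for linear differential equations phi is the flow
    ([orbit_is_flow], [semigroup_is_flow]).  So phi_t is linear fractional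
    ([semigroup_linear_fractional]) and, by continuity up to the circle,
    |n| <= |d| there; equality holds at t = 0, so the form has a nonpositive
    derivative at t = 0 ([circle_rate_le0]).

    A generator of linear fractional maps is quadratic because such maps
    preserve cross-ratios: differentiating this invariance at t = 0 expresses
    G(z) through its values at three points exactly as Lagrange interpolation
    does ([lft_generator_quadratic]).

    In the equality case the form is conserved, so the flow also preserves the
    disc backwards in time and consists of automorphisms
    ([coef_form_automorphisms]).  Conversely an automorphism phi_t cannot send
    a point of the circle into the disc, that image being already taken by a
    point of the disc; the form thus vanishes on the circle at all times, and
    so does its derivative ([automorphic_circle_rate_eq0]). *)

(** * Derivatives of complex paths on the half-line *)

Section PathDerivatives.
Variable R : realType.
Local Notation C := (R[i]^o).
Implicit Types (f g : R -> C) (t : R) (l : C).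

(** The increments used by [generator_of]: two-sided for t > 0, one-sided at
    t = 0.  With them a generator hypothesis is literally a [path_deriv]. *)
Definition steps (t : R) : set_system R :=
  within [set h | 0 <= t + h] (0 : R)^'.

Global Instance steps_filter t : Filter (steps t).
Proof. exact: within_filter. Qed.

Definition path_deriv f t l :=
  (f (t + h) - f t) / h%:C%C @[h --> steps t] --> l.

Lemma at_right_steps t : 0 <= t -> (0 : R)^'+ `=>` steps t.
Proof.
move=> t0 A H; apply: filterS (H : nbhs (0 : R) _) => h /= Ah h0.
by apply: Ah; [rewrite gt_eqF | rewrite addr_ge0// ltW].
Qed.

Lemma steps_neq0 t : \forall h \near steps t, h != 0.
Proof.
have H : \forall h \near (0 : R)^', h != 0 by exact: nbhs_dnbhs_neq.
by rewrite /steps /within/= near_withinE; apply: filterS H.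
Qed.

Lemma steps_cvg0 t : h @[h --> steps t] --> (0 : R).
Proof.
apply: cvg_trans; first exact: cvg_within.
exact: cvg_within.
Qed.

Lemma cvg_real_complex (T : Type) (F : set_system T) (FF : Filter F)
    (f : T -> R) (l : R) :
  f x @[x --> F] --> l -> ((f x)%:C%C : C) @[x --> F] --> (l%:C%C : C).
Proof.
move=> fl; apply/cvgrPdist_lt => e e0.
have e0' : 0 < complex.Re e by move: e0; rewrite ltcE => /andP[].
have -> : e = (complex.Re e)%:C%C by rewrite RRe_real// gtr0_real.
move/cvgrPdist_lt: fl => /(_ _ e0'); apply: filterS => x.
by rewrite -rmorphB normc_def /= expr0n addr0 sqrtr_sqr ltcR.
Qed.

Lemma cvgMC (T : Type) (F : set_system T) (FF : Filter F)
    (f g : T -> C) (a b : C) :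
  f x @[x --> F] --> a -> g x @[x --> F] --> b ->
  f x * g x @[x --> F] --> a * b.
Proof. exact: cvgM. Qed.

Lemma cvgDC (T : Type) (F : set_system T) (FF : Filter F)
    (f g : T -> C) (a b : C) :
  f x @[x --> F] --> a -> g x @[x --> F] --> b ->
  f x + g x @[x --> F] --> a + b.
Proof. exact: cvgD. Qed.

Lemma cvgBC (T : Type) (F : set_system T) (FF : Filter F)
    (f g : T -> C) (a b : C) :
  f x @[x --> F] --> a -> g x @[x --> F] --> b ->
  f x - g x @[x --> F] --> a - b.
Proof. exact: cvgB. Qed.

Lemma cvgVC (T : Type) (F : set_system T) (FF : Filter F)
    (f : T -> C) (a : C) :
  a != 0 -> f x @[x --> F] --> a -> (f x)^-1 @[x --> F] --> a^-1.
Proof. exact: cvgV. Qed.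

Lemma path_deriv_eq f t l l' :
  path_deriv f t l -> l = l' -> path_deriv f t l'.
Proof. by move=> fl <-. Qed.

Lemma path_deriv_cst l t : path_deriv (fun=> l) t 0.
Proof.
by rewrite /path_deriv; apply: cvg_near_cst; near=> h; rewrite subrr mul0r.
Unshelve. all: by end_near. Qed.

Lemma path_deriv_cvg f t l : path_deriv f t l ->
  f (t + h) @[h --> steps t] --> f t.
Proof.
move=> fl.
have h0 : (h%:C%C : C) @[h --> steps t] --> (0 : C).
  by apply: cvg_real_complex; exact: steps_cvg0.
rewrite -[X in _ --> X]add0r -(mulr0 l).
have : ((f (t + h) - f t) / h%:C%C) * h%:C%C + f t
    @[h --> steps t] --> l * 0 + f t.
  exact: (cvgDC _ (cvgMC _ fl h0) (cvg_cst _)).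
apply: cvg_trans; apply: near_eq_cvg.
near=> h => /=.
rewrite divfK ?subrK//.
have : h != 0 by near: h; exact: steps_neq0.
by apply: contraNN => /eqP [->].
Unshelve. all: by end_near. Qed.

Lemma path_derivM f g t (l l' : C) : path_deriv f t l -> path_deriv g t l' ->
  path_deriv (fun s => f s * g s : C) t (l * g t + f t * l').
Proof.
move=> fl gl.
have : (f (t + h) - f t) / h%:C%C * g (t + h) +
   f t * ((g (t + h) - g t) / h%:C%C)
   @[h --> steps t] --> l * g t + f t * l'.
  exact: (cvgDC _ (cvgMC _ fl (path_deriv_cvg gl)) (cvgMC _ (cvg_cst _) gl)).
apply: cvg_trans; apply: near_eq_cvg; near=> h => /=.
set a := f _; set b := g _; set c := f _; set d := g _; set e := h%:C%C.
rewrite mulrA [_ / e * b]mulrAC -mulrDl; congr (_ / _).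
by rewrite mulrBl mulrBr addrA subrK.
Unshelve. all: by end_near. Qed.

Lemma path_derivD f g t (l l' : C) : path_deriv f t l -> path_deriv g t l' ->
  path_deriv (fun s => f s + g s : C) t (l + l').
Proof.
move=> fl gl.
have : (f (t + h) - f t) / h%:C%C + (g (t + h) - g t) / h%:C%C
   @[h --> steps t] --> l + l' by exact: (cvgDC _ fl gl).
apply: cvg_trans; apply: near_eq_cvg; near=> h => /=.
by rewrite -mulrDl opprD addrACA.
Unshelve. all: by end_near. Qed.

Lemma path_derivB f g t (l l' : C) : path_deriv f t l -> path_deriv g t l' ->
  path_deriv (fun s => f s - g s : C) t (l - l').
Proof.
move=> fl gl.
have : (f (t + h) - f t) / h%:C%C - (g (t + h) - g t) / h%:C%C
   @[h --> steps t] --> l - l' by exact: (cvgBC _ fl gl).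
apply: cvg_trans; apply: near_eq_cvg; near=> h => /=.
by rewrite -mulrBl opprD addrACA -opprD.
Unshelve. all: by end_near. Qed.

Lemma path_derivV f t (l : C) : f t != 0 -> path_deriv f t l ->
  path_deriv (fun s => (f s)^-1 : C) t (- l / (f t * f t)).
Proof.
move=> f0 fl.
have key (K : fieldType) (a b e : K) : a != 0 -> b != 0 ->
    - ((b - a) / e) / (a * b) = (b^-1 - a^-1) / e.
  by move=> a0 b0; rewrite -mulNr mulrAC; congr (_ / e); field; rewrite a0 b0.
have fc := path_deriv_cvg fl.
have : - ((f (t + h) - f t) / h%:C%C) / (f t * f (t + h))
   @[h --> steps t] --> - l / (f t * f t).
  apply: (cvgMC _ (cvgN fl)); apply: cvgVC; first by rewrite mulf_neq0.
  exact: (cvgMC _ (cvg_cst _) fc).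
apply: cvg_trans; apply: near_eq_cvg; near=> h => /=.
have fh0 : f (t + h) != 0.
  near: h.
  have /cvgrPdist_lt/(_ `|f t|) := fc.
  rewrite normr_gt0 => /(_ f0); apply: filterS => h.
  by apply: contraTneq => ->; rewrite subr0 ltxx.
exact: key.
Unshelve. all: by end_near. Qed.

Lemma cvg_conj (T : Type) (F : set_system T) (FF : Filter F)
    (f : T -> C) (l : C) :
  f x @[x --> F] --> l -> ((f x)^* : C) @[x --> F] --> (l^* : C).
Proof.
move=> fl; apply/cvgrPdist_lt => e e0.
move/cvgrPdist_lt: fl => /(_ _ e0); apply: filterS => x.
by rewrite -rmorphB norm_conjC.
Qed.

Lemma path_deriv_conj f t (l : C) : path_deriv f t l ->
  path_deriv (fun s => (f s)^* : C) t (l^*).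
Proof.
move=> fl.
have : (((f (t + h) - f t) / h%:C%C)^* : C) @[h --> steps t] --> (l^* : C).
  exact: cvg_conj.
apply: cvg_trans; apply: near_eq_cvg; near=> h => /=.
rewrite rmorphM rmorphB fmorphV /=; congr (_ / _).
exact: (conjc_real h).
Unshelve. all: by end_near. Qed.

Lemma cvg_Re (T : Type) (F : set_system T) (FF : Filter F)
    (f : T -> C) (l : C) :
  f x @[x --> F] --> l -> complex.Re (f x) @[x --> F] --> complex.Re l.
Proof.
move=> fl; apply/cvgrPdist_lt => e e0.
have ec : 0 < e%:C%C :> R[i] by rewrite ltcR.
move/cvgrPdist_lt: fl => /(_ _ ec); apply: filterS => x.
move=> /(le_lt_trans (normc_ge_Re _)); rewrite ltcR.
by rewrite (raddfB (@complex.Re R)).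
Qed.

Lemma Re_div (z : R[i]) (k : R) : complex.Re (z / k%:C%C) = complex.Re z / k.
Proof. by rewrite -fmorphV; case: z => a b /=; rewrite mulr0 subr0. Qed.

Lemma path_deriv_Re f t l : path_deriv f t l ->
  (complex.Re (f (t + h)) - complex.Re (f t)) / h
    @[h --> steps t] --> complex.Re l.
Proof.
move=> /(cvg_Re (steps_filter t)); apply: cvg_trans; apply: near_eq_cvg.
near=> h => /=; by rewrite Re_div (raddfB (@complex.Re R)).
Unshelve. all: by end_near. Qed.

Lemma dnbhs_steps t : 0 < t -> (0 : R)^' `=>` steps t.
Proof.
move=> t0 A H; rewrite /dnbhs/= /within/=.
have {}H : \forall h \near (0 : R), h != 0 -> 0 <= t + h -> A h := H.
near=> h => h0; apply: (near H h) => //; near: h.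
exists t => //= h /=; rewrite sub0r normrN ltr_norml => /andP[+ _].
by rewrite -subr_gt0 opprK addrC => /ltW.
Unshelve. all: by end_near. Qed.

(** The mean value theorem on [0, +oo[, with differentiability inside and, from
    the one-sided [path_deriv], right continuity at the end point 0. *)
Lemma path_Re_nonincreasing f (l : R -> C) t :
  (forall s : R, 0 <= s -> path_deriv f s (l s)) ->
  (forall s : R, 0 <= s -> 'Re (l s) <= 0) -> 0 <= t -> 'Re (f t) <= 'Re (f 0).
Proof.
move=> fl l0 t0; rewrite -!complexRe lecR.
have d (s : R) : 0 < s ->
    is_derive s 1 (fun s : R => complex.Re (f s)) (complex.Re (l s)).
  move=> s0.
  have : h^-1 *: (complex.Re (f (h *: 1 + s)) - complex.Re (f s))
     @[h --> (0 : R)^'] --> complex.Re (l s).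
    have := cvg_trans (cvg_app _ (dnbhs_steps s0))
      (path_deriv_Re (fl s (ltW s0))).
    apply: cvg_trans; apply: near_eq_cvg; near=> h => /=.
    by rewrite mulrC [_ *: 1]mulr1 [h + s]addrC.
  move=> H; split; first by apply/cvg_ex; exists (complex.Re (l s)).
  exact/cvg_lim.
apply: (@ler0_derive1_nincry _ (fun s : R => complex.Re (f s)) 0) => //.
- by move=> s; rewrite in_itv/= andbT => /d.
- move=> s; rewrite in_itv/= andbT => s0; rewrite derive1E.
  have -> := @derive_val _ _ _ _ _ _ _ (d s s0).
  by rewrite -lecR complexRe; apply: l0; exact: ltW.
- apply/continuous_within_itvcyP; split.
    move=> s; rewrite in_itv/= andbT => /d.
    by move=> ?; apply/differentiable_continuous/derivable1_diffP.
  have := cvg_trans (cvg_app _ (at_right_steps (lexx 0)))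
    (cvg_Re (steps_filter 0) (path_deriv_cvg (fl 0 (lexx _)))).
  by apply: cvg_trans; apply: near_eq_cvg; near=> h; rewrite add0r.
Unshelve. all: by end_near. Qed.

Lemma path_deriv0_Re_le0 f l :
  path_deriv f 0 l -> (forall t, 0 <= t -> 'Re (f t) <= 'Re (f 0)) -> 'Re l <= 0.
Proof.
move=> fl H.
have H0 := cvg_trans (cvg_app _ (at_right_steps (lexx 0)))
  (path_deriv_Re fl).
rewrite -complexRe lecR.
apply: (closed_cvg [set x : R | x <= 0] (@closed_le _ (0 : R)) _ _ H0).
near=> h.
have h0 : 0 < h by near: h; exact: nbhs_right_gt.
by rewrite /= ler_pdivrMr// mul0r subr_le0 add0r -lecR !complexRe H// ltW.
Unshelve. all: by end_near. Qed.

Lemma path_deriv_unique f t l l' : 0 <= t -> path_deriv f t l ->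
  path_deriv f t l' -> l = l'.
Proof.
move=> t0 h1 h2.
have uniq := @cvg_unique C (@norm_hausdorff _ C) _
  (fmap_proper_filter (fun h => (f (t + h) - f t) / h%:C%C : C)
    (at_right_proper_filter (0 : R))).
by apply: uniq; [apply: cvg_trans h1 | apply: cvg_trans h2];
  exact: (cvg_app _ (at_right_steps t0)).
Qed.

Lemma real_path_deriv (f : R -> R) t (l : R) : is_derive t 1 f l ->
  path_deriv (fun s => (f s)%:C%C : C) t (l%:C%C).
Proof.
move=> [fd <-].
have : h^-1 *: (f (h *: 1 + t) - f t) @[h --> (0 : R)^'] --> 'D_1 f t by [].
move=> H.
have := cvg_real_complex (steps_filter t)
  (cvg_trans (cvg_app _
    (@cvg_within _ _ (dnbhs_filter (0 : R)) [set h | 0 <= t + h])) H).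
apply: cvg_trans; apply: near_eq_cvg; near=> h => /=.
by rewrite [_ *: 1]mulr1 [h + t]addrC rmorphM rmorphB fmorphV mulrC.
Unshelve. all: by end_near. Qed.

Lemma path_deriv_vanishing (f : R -> C) (l : C) :
  (forall t : R, 0 <= t -> f t = 0) -> path_deriv f 0 l -> l = 0.
Proof.
move=> f0 fl; apply: (path_deriv_unique (lexx 0) fl).
apply: cvg_near_cst; near=> h; rewrite !f0 ?subrr ?mul0r//.
near: h. exact: withinT.
Unshelve. all: by end_near. Qed.

End PathDerivatives.

(** * The functions cosh(mt) and sinh(mt)/m *)

Section HyperbolicFunctions.
Variable R : realType.
Local Notation C := (R[i]^o).
Implicit Types (m : R[i]) (s t : R).

Definition cexp m t : R[i] :=
  (expR (complex.Re m * t))%:C%C *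
  ((cos (complex.Im m * t))%:C%C + 'i%C * (sin (complex.Im m * t))%:C%C).

Lemma cexp0 m : cexp m 0 = 1.
Proof. by rewrite /cexp !mulr0 expR0 cos0 sin0 mulr0 addr0 mulr1. Qed.

Lemma cexp0l t : cexp 0 t = 1.
Proof. by rewrite /cexp !mul0r expR0 cos0 sin0 mulr0 addr0 mulr1. Qed.

Lemma cexpD m s t : cexp m (s + t) = cexp m s * cexp m t.
Proof.
rewrite /cexp !mulrDr expRD cosD sinD; set a := expR _; set b := expR _.
set c := cos _; set d := cos _; set e := sin _; set f := sin _.
rewrite rmorphM rmorphB rmorphD /= !rmorphM /=.
have ii : 'i%C * 'i%C = -1 :> R[i] by rewrite -expr2 sqr_i.
have -> : c%:C%C * d%:C%C - e%:C%C * f%:C%C =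
   c%:C%C * d%:C%C + ('i%C * 'i%C) * (e%:C%C * f%:C%C) by rewrite ii mulN1r.
by ring.
Qed.

Lemma cexp_deriv m t : path_deriv (cexp m : R -> C) t (m * cexp m t : C).
Proof.
case: m => a b; rewrite /cexp /=.
have de : is_derive t 1 (fun s : R => expR (a * s)) (a * expR (a * t)).
  by apply: is_derive_eq; rewrite [_%:A]mulr1 [LHS]mulrC.
have dc : is_derive t 1 (fun s : R => cos (b * s)) (- b * sin (b * t)).
  by apply: is_derive_eq; rewrite [_%:A]mulr1 [LHS]mulrC mulrN mulNr.
have ds : is_derive t 1 (fun s : R => sin (b * s)) (b * cos (b * t)).
  by apply: is_derive_eq; rewrite [_%:A]mulr1 [LHS]mulrC.
apply: path_deriv_eq (path_derivM (real_path_deriv de)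
  (path_derivD (real_path_deriv dc)
    (path_derivM (path_deriv_cst ('i%C : C) t) (real_path_deriv ds)))) _.
have -> : (a +i* b)%C = a%:C%C + 'i%C * b%:C%C by rewrite [LHS]complexE.
have ii : 'i%C * 'i%C = -1 :> R[i] by rewrite -expr2 sqr_i.
have key (K : comNzRingType) (i A B E c s : K) : i * i = -1 ->
  A * E * (c + i * s) + E * (- B * s + (0 * s + i * (B * c))) =
  (A + i * B) * (E * (c + i * s)).
  move=> i2; transitivity
    (A * E * (c + i * s) + E * ((-1) * B * s + i * (B * c))); first by ring.
  by rewrite -i2; ring.
by rewrite !rmorphM rmorphN /=; exact: key.
Qed.

Definition ccosh m t : R[i] := (cexp m t + cexp (- m) t) / 2.

(** The value at m = 0 is the limit of sinh(mt)/m, so that [csinhc] is the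
    entire function of m^2 that occurs in exp(tM). *)
Definition csinhc m t : R[i] :=
  if m == 0 then t%:C%C else (cexp m t - cexp (- m) t) / (2 * m).

Lemma ccosh0 m : ccosh m 0 = 1.
Proof. by rewrite /ccosh !cexp0 -[1 + 1]/(2%:R) divff// pnatr_eq0. Qed.

Lemma csinhc0 m : csinhc m 0 = 0.
Proof. by rewrite /csinhc !cexp0 subrr mul0r; case: ifP. Qed.

Lemma ccoshD m s t :
  ccosh m (s + t) = ccosh m s * ccosh m t + m ^+ 2 * (csinhc m s * csinhc m t).
Proof.
rewrite /ccosh /csinhc !cexpD; have [->|m0] := eqVneq m 0.
  by rewrite oppr0 !cexp0l; field.
by field.
Qed.

Lemma csinhcD m s t :
  csinhc m (s + t) = csinhc m s * ccosh m t + ccosh m s * csinhc m t.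
Proof.
rewrite /ccosh /csinhc !cexpD; have [->|m0] := eqVneq m 0.
  by rewrite oppr0 !cexp0l rmorphD /=; field.
by field.
Qed.

Lemma ccosh_deriv m t :
  path_deriv (ccosh m : R -> C) t (m ^+ 2 * csinhc m t : C).
Proof.
apply: path_deriv_eq (path_derivM
  (path_derivD (@cexp_deriv m t) (@cexp_deriv (- m) t))
  (path_deriv_cst (2^-1 : C) t)) _.
rewrite /csinhc mulr0 addr0; have [->|m0] := eqVneq m 0.
  by rewrite oppr0 !cexp0l !mul0r addr0 mul0r expr2 !mul0r.
by move: (cexp m t) (cexp (- m) t) => a b; field.
Qed.

Lemma csinhc_deriv m t : path_deriv (csinhc m : R -> C) t (ccosh m t : C).
Proof.
rewrite /csinhc /ccosh; have [->|m0] := eqVneq m 0.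
  apply: path_deriv_eq (real_path_deriv (is_derive_id t 1)) _.
  by rewrite oppr0 !cexp0l; field.
apply: path_deriv_eq (path_derivM
  (path_derivB (@cexp_deriv m t) (@cexp_deriv (- m) t))
  (path_deriv_cst ((2 * m)^-1 : C) t)) _.
by move: (cexp m t) (cexp (- m) t) => a b; rewrite mulr0 addr0; field.
Qed.
End HyperbolicFunctions.

(** * The Hermitian form |n|^2 - |d|^2 and the dissipativity condition *)

Section DissipationAlgebra.
Variable K : numClosedFieldType.
Implicit Types (z a b k n d alpha beta gamma : K).

Lemma Re_le_norm z : 'Re z <= `|z|.
Proof.
apply: le_trans (leif_normC_Re_Creal z).
by rewrite real_ler_norm// Creal_Re.
Qed.

(** The disc is the set of ratios n/d with negative [energy]. *)
Definition energy n d : K := n * n^* - d * d^*.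

Lemma energyE n d : energy n d = `|n| ^+ 2 - `|d| ^+ 2.
Proof. by rewrite !normCK. Qed.

Lemma Re_energy n d : 'Re (energy n d) = `|n| ^+ 2 - `|d| ^+ 2.
Proof.
by rewrite energyE; apply/Creal_ReP; rewrite rpredB// rpredX// normr_real.
Qed.

Lemma energy_lt0 n d : (`|n| ^+ 2 - `|d| ^+ 2 < 0) = (`|n| < `|d|).
Proof. by rewrite subr_lt0 ltr_pXn2r// nnegrE. Qed.

Lemma energy_le0 n d : (`|n| ^+ 2 - `|d| ^+ 2 <= 0) = (`|n| <= `|d|).
Proof. by rewrite subr_le0 ler_pXn2r// nnegrE. Qed.

(** The derivative of [energy] along (n, d)' = M (n, d). *)
Definition energy_rate alpha beta gamma n d : K :=
  let n' := beta / 2 * n + gamma * d in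
  let d' := - (alpha * n + beta / 2 * d) in
  (n' * n^* + n * n'^*) - (d' * d^* + d * d'^*).

Lemma Re_energy_rate alpha beta gamma n d :
  'Re (energy_rate alpha beta gamma n d) =
  'Re beta * (`|n| ^+ 2 + `|d| ^+ 2) + 2 * 'Re ((alpha + gamma^*) * (n * d^*)).
Proof.
rewrite !ReE /energy_rate !normCK.
have c2 : (2^-1 : K)^* = 2^-1 by rewrite fmorphV rmorph_nat.
rewrite !(rmorphD, rmorphB, rmorphM, rmorphN) /= !conjCK !c2.
move: (n^*) (d^*) (alpha^*) (beta^*) (gamma^*) => n' d' a' b' g'.
by field.
Qed.

Lemma Re_energy_rate_circle alpha beta gamma z : `|z| = 1 ->
  'Re (energy_rate alpha beta gamma z 1) =
  2 * ('Re beta + 'Re ((alpha + gamma^*) * z)).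
Proof.
move=> z1; rewrite Re_energy_rate z1 normr1 expr1n rmorph1 mulr1.
by rewrite -mulr2n [RHS]mulrDr mulrC.
Qed.

(** Bounding Re((alpha + conj gamma) n conj d) by -Re beta |n| |d| completes the
    square: the bound obtained is Re beta (|n| - |d|)^2. *)
Lemma Re_energy_rate_le0 alpha beta gamma n d :
  'Re beta + `|alpha + gamma^*| <= 0 ->
  'Re (energy_rate alpha beta gamma n d) <= 0.
Proof.
move=> H; have Hk : `|alpha + gamma^*| <= - 'Re beta.
  by rewrite -subr_le0 opprK addrC.
rewrite Re_energy_rate; set k := alpha + _ in Hk *.
apply: (@le_trans _ _ ('Re beta * (`|n| ^+ 2 + `|d| ^+ 2) +
    2 * (- 'Re beta * (`|n| * `|d|)))).
  rewrite lerD2l ler_pM2l ?ltr0n//; apply: le_trans (Re_le_norm _) _.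
  by rewrite normrM normrM norm_conjC ler_wpM2r// mulr_ge0.
have -> : 'Re beta * (`|n| ^+ 2 + `|d| ^+ 2) +
  2 * (- 'Re beta * (`|n| * `|d|)) = 'Re beta * (`|n| - `|d|) ^+ 2 by ring.
have b0 : 'Re beta <= 0 by rewrite -oppr_ge0; apply: le_trans Hk.
by rewrite mulr_le0_ge0// real_exprn_even_ge0// rpredB// normr_real.
Qed.

Lemma boundary_Re alpha beta gamma z : `|z| = 1 ->
  'Re ((alpha * z ^+ 2 + beta * z + gamma) * z^*) =
  'Re beta + 'Re ((alpha + gamma^*) * z).
Proof.
move=> z1; have zz : z * z^* = 1 by rewrite -normCK z1 expr1n.
have -> : (alpha * z ^+ 2 + beta * z + gamma) * z^* =
  beta * (z * z^*) + alpha * z * (z * z^*) + gamma * z^* by ring.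
rewrite zz !mulr1 !raddfD /= mulrDl raddfD /= -addrA; congr (_ + (_ + _)).
by rewrite -Re_conj rmorphM /= conjCK.
Qed.

Lemma unit_rotation k : exists2 z, `|z| = 1 & k * z = `|k|.
Proof.
have [->|k0] := eqVneq k 0; first by exists 1; rewrite ?normr1// mul0r normr0.
exists (k^* / `|k|).
  by rewrite normrM normfV normr_id norm_conjC divff// normr_eq0.
by rewrite mulrA -normCK expr2 mulfK// normr_eq0.
Qed.

Lemma Re_circle_le0 b k : (forall z, `|z| = 1 -> 'Re b + 'Re (k * z) <= 0) <->
  'Re b + `|k| <= 0.
Proof.
split=> [H|H z z1].
  have [z z1 kz] := unit_rotation k; have := H _ z1.
  by rewrite kz (Creal_ReP `|k| _)// normr_real.
apply: le_trans H; rewrite lerD2l; apply: le_trans (Re_le_norm _) _.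
by rewrite normrM z1 mulr1.
Qed.

(** A rotation with k z = |k| and its opposite give Re b + |k| = 0 = Re b - |k|. *)
Lemma Re_circle_eq0 b k : (forall z, `|z| = 1 -> 'Re b + 'Re (k * z) = 0) <->
  'Re b = 0 /\ `|k| = 0.
Proof.
split=> [H|[-> /normr0_eq0 -> z _]]; last by rewrite mul0r raddf0 addr0.
have [z z1 kz] := unit_rotation k.
have rk : 'Re `|k| = `|k| by apply/Creal_ReP; rewrite normr_real.
have := H _ z1; rewrite kz rk => E1.
have := H (- z); rewrite normrN => /(_ z1).
rewrite mulrN kz raddfN /= rk => E2.
have k0 : `|k| = 0.
  have H2 : `|k| *+ 2 = ('Re b + `|k|) - ('Re b - `|k|) by ring.
  by move/eqP: H2; rewrite E1 E2 subr0 mulrn_eq0 => /eqP.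
by move: E1; rewrite k0 addr0.
Qed.
End DissipationAlgebra.

(** * The Riccati flow *)

Section RiccatiFlow.
Variable R : realType.
Local Notation C := (R[i]^o).
Variables alpha beta gamma : R[i].
Implicit Types (s t : R) (x y z w k : R[i]).

Definition riccati_rate : R[i] := sqrtC ((beta / 2) ^+ 2 - alpha * gamma).
Local Notation Ch := (ccosh riccati_rate).
Local Notation Sh := (csinhc riccati_rate).

(** (flow_num t x y, flow_den t x y) is exp(tM) (x, y). *)
Definition flow_num t x y : R[i] :=
  Ch t * x + Sh t * (beta / 2 * x + gamma * y).
Definition flow_den t x y : R[i] :=
  Ch t * y - Sh t * (alpha * x + beta / 2 * y).

Lemma flow_num0 x y : flow_num 0 x y = x.
Proof. by rewrite /flow_num ccosh0 csinhc0 mul1r mul0r addr0. Qed.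

Lemma flow_den0 x y : flow_den 0 x y = y.
Proof. by rewrite /flow_den ccosh0 csinhc0 mul1r mul0r subr0. Qed.

Lemma flow_numD t s x y :
  flow_num (t + s) x y = flow_num t (flow_num s x y) (flow_den s x y).
Proof.
rewrite /flow_num /flow_den ccoshD csinhcD sqrtCK.
by move: (Ch t) (Ch s) (Sh t) (Sh s) (beta / 2) => c c' e e' b; ring.
Qed.

Lemma flow_denD t s x y :
  flow_den (t + s) x y = flow_den t (flow_num s x y) (flow_den s x y).
Proof.
rewrite /flow_num /flow_den ccoshD csinhcD sqrtCK.
by move: (Ch t) (Ch s) (Sh t) (Sh s) (beta / 2) => c c' e e' b; ring.
Qed.

Lemma flow_num_scale t k x y : flow_num t (k * x) (k * y) = k * flow_num t x y.
Proof. by rewrite /flow_num; move: (beta / 2) => b; ring. Qed.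

Lemma flow_den_scale t k x y : flow_den t (k * x) (k * y) = k * flow_den t x y.
Proof. by rewrite /flow_den; move: (beta / 2) => b; ring. Qed.

Lemma flow_num_lin t x y :
  flow_num t x y = x * flow_num t 1 0 + y * flow_num t 0 1.
Proof. by rewrite /flow_num; move: (beta / 2) => b; ring. Qed.

Lemma flow_den_lin t x y :
  flow_den t x y = x * flow_den t 1 0 + y * flow_den t 0 1.
Proof. by rewrite /flow_den; move: (beta / 2) => b; ring. Qed.

Lemma flow_numK t x y : flow_num (- t) (flow_num t x y) (flow_den t x y) = x.
Proof. by rewrite -flow_numD addNr flow_num0. Qed.

Lemma flow_denK t x y : flow_den (- t) (flow_num t x y) (flow_den t x y) = y.
Proof. by rewrite -flow_denD addNr flow_den0. Qed.

Lemma flow_eq0 t x y :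
  flow_num t x y = 0 -> flow_den t x y = 0 -> x = 0 /\ y = 0.
Proof.
move=> n0 d0; have n00 s : flow_num s 0 0 = 0.
  by rewrite flow_num_lin !mul0r addr0.
have d00 s : flow_den s 0 0 = 0 by rewrite flow_den_lin !mul0r addr0.
have := flow_numK t x y; have := flow_denK t x y; rewrite n0 d0 n00 d00.
by move=> <- <-.
Qed.

Lemma flow_num_deriv t x y : path_deriv (fun t => flow_num t x y : C) t
  (beta / 2 * flow_num t x y + gamma * flow_den t x y : C).
Proof.
apply: path_deriv_eq (path_derivD
  (path_derivM (@ccosh_deriv _ riccati_rate t) (path_deriv_cst (x : C) t))
  (path_derivM (@csinhc_deriv _ riccati_rate t)
    (path_deriv_cst (beta / 2 * x + gamma * y : C) t))) _.
rewrite !mulr0 !addr0 /flow_num /flow_den sqrtCK.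
by move: (Ch t) (Sh t) (beta / 2) => c e b; ring.
Qed.

Lemma flow_den_deriv t x y : path_deriv (fun t => flow_den t x y : C) t
  (- (alpha * flow_num t x y + beta / 2 * flow_den t x y) : C).
Proof.
apply: path_deriv_eq (path_derivB
  (path_derivM (@ccosh_deriv _ riccati_rate t) (path_deriv_cst (y : C) t))
  (path_derivM (@csinhc_deriv _ riccati_rate t)
    (path_deriv_cst (alpha * x + beta / 2 * y : C) t))) _.
rewrite !mulr0 !addr0 /flow_num /flow_den sqrtCK.
by move: (Ch t) (Sh t) (beta / 2) => c e b; ring.
Qed.

Lemma flow_energy_deriv t x y :
  path_deriv (fun t => energy (flow_num t x y) (flow_den t x y) : C) t
    (energy_rate alpha beta gamma (flow_num t x y) (flow_den t x y) : C).
Proof.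
have dn := @flow_num_deriv t x y; have dd := @flow_den_deriv t x y.
exact: (path_derivB (path_derivM dn (path_deriv_conj dn))
  (path_derivM dd (path_deriv_conj dd))).
Qed.

Lemma flow_energy_le t x y :
  'Re beta + `|alpha + gamma^*| <= 0 -> 0 <= t ->
  `|flow_num t x y| ^+ 2 - `|flow_den t x y| ^+ 2 <= `|x| ^+ 2 - `|y| ^+ 2.
Proof.
move=> H t0.
have := path_Re_nonincreasing (fun s _ => @flow_energy_deriv s x y)
  (fun s _ => Re_energy_rate_le0 _ _ H) t0.
by rewrite flow_num0 flow_den0 !Re_energy.
Qed.

Lemma flow_energy_eq t x y :
  (forall n d, 'Re (energy_rate alpha beta gamma n d) = 0) -> 0 <= t ->
  `|flow_num t x y| ^+ 2 - `|flow_den t x y| ^+ 2 = `|x| ^+ 2 - `|y| ^+ 2.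
Proof.
move=> rate0 t0; have le0 n d : 'Re (energy_rate alpha beta gamma n d) <= 0.
  by rewrite rate0.
apply/eqP; rewrite eq_le; apply/andP; split.
  have := path_Re_nonincreasing (fun s _ => @flow_energy_deriv s x y)
    (fun s _ => le0 _ _) t0.
  by rewrite flow_num0 flow_den0 !Re_energy.
have := path_Re_nonincreasing
  (fun s _ => path_derivB (path_deriv_cst (0 : C) s)
    (@flow_energy_deriv s x y)) _ t0.
rewrite flow_num0 flow_den0 !sub0r !raddfN /= !Re_energy lerN2; apply=> s _.
by rewrite sub0r raddfN /= rate0 oppr0.
Qed.

Definition flow t z : R[i] := flow_num t z 1 / flow_den t z 1.

Lemma flowD t s z : flow_den s z 1 != 0 -> flow (t + s) z = flow t (flow s z).
Proof.
move=> d0; rewrite /flow flow_numD flow_denD.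
set n := flow_num s z 1; set d := flow_den s z 1 in d0 *.
have -> : flow_num t n d = d * flow_num t (n / d) 1.
  by rewrite -flow_num_scale mulr1 [d * _]mulrC divfK.
have -> : flow_den t n d = d * flow_den t (n / d) 1.
  by rewrite -flow_den_scale mulr1 [d * _]mulrC divfK.
by rewrite -mulf_div divff// mul1r.
Qed.

Lemma flow0 z : flow 0 z = z.
Proof. by rewrite /flow flow_num0 flow_den0 divr1. Qed.

Lemma flowK t z : flow_den t z 1 != 0 -> flow (- t) (flow t z) = z.
Proof. by move=> d0; rewrite -flowD// addNr flow0. Qed.

(** As sinh(mt)/m vanishes at t = 0, this exhibits the uniform convergence of the
    flow to the identity. *)
Lemma flow_subE t z : flow_den t z 1 != 0 ->
  flow t z - z = Sh t * (alpha * z ^+ 2 + beta * z + gamma) / flow_den t z 1.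
Proof.
move=> d0; apply: (mulIf d0); rewrite mulrBl !divfK// /flow_num /flow_den.
by field.
Qed.

Lemma flow_deriv t z : flow_den t z 1 != 0 ->
  path_deriv (fun t => flow t z : C) t
    (alpha * flow t z ^+ 2 + beta * flow t z + gamma : C).
Proof.
move=> d0; apply: path_deriv_eq (path_derivM (@flow_num_deriv t z 1)
  (path_derivV d0 (@flow_den_deriv t z 1))) _; rewrite /flow.
by move: (flow_num t z 1) (flow_den t z 1) d0 => n d d0; field.
Qed.

End RiccatiFlow.

(** * Sample points of the disc *)

Lemma unit_disc_samples (R : realType) :
  [/\ unit_disc (0 : R[i]^o), unit_disc (2^-1 : R[i]^o) &
      unit_disc (- 2^-1 : R[i]^o)].
Proof.
split; rewrite /unit_disc/= ?normr0 ?ltr01// ?normrN.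
all: by rewrite normfV normr_nat invf_lt1 ?ltr1n ?ltr0n.
Qed.

(** * Dissipative quadratic fields generate semigroups *)

Section FlowSemigroup.
Variable R : realType.
Local Notation C := (R[i]^o).
Variables alpha beta gamma : R[i].
Local Notation fnum := (flow_num alpha beta gamma).
Local Notation fden := (flow_den alpha beta gamma).
Local Notation phi := (flow alpha beta gamma).
Implicit Types (t s : R) (z : R[i]).

Lemma flow_derivable t (z : C) :
  fden t z 1 != 0 -> derivable (phi t : C -> C) z 1.
Proof.
move=> d0.
have affine (A B : C) : derivable (fun z : C => z * A + 1 * B : C) z 1.
  apply: derivableD; last exact: derivable_cst.
  by apply: derivableM; [exact: derivable_id | exact: derivable_cst].
have -> : (phi t : C -> C) = fun z =>
    (z * fnum t 1 0 + 1 * fnum t 0 1) / (z * fden t 1 0 + 1 * fden t 0 1).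
  apply/funext => w.
  by rewrite /flow (flow_num_lin _ _ _ _ w) (flow_den_lin _ _ _ _ w).
apply: derivableM; first exact: affine.
apply: derivableV; last exact: affine.
by move: d0; rewrite flow_den_lin.
Qed.

(** By [flow_subE] the displacement is sinh(mt)/m G(z) / d: near t = 0 the
    denominator d is close to 1 and the first factor is small, uniformly in z. *)
Lemma flow_near_id (e : R[i]) : 0 < e -> \forall t \near (0 : R)^'+,
  forall z, `|z| <= 1 -> `|z - phi t z| < e.
Proof.
(* k bounds |G(z)| and |alpha z + beta/2| for |z| <= 1 *)
move=> e0; pose k := 1 + `|alpha| + `|beta| + `|gamma|.
have k1 : 1 <= k by rewrite /k -!addrA lerDl !addr_ge0.
have k0 : 0 < k by apply: lt_le_trans k1.
pose m := riccati_rate alpha beta gamma.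
have to0 (f : R -> C) (l a : C) (d : R[i]) :
    path_deriv f 0 l -> f 0 = a -> 0 < d ->
    \forall t \near (0 : R)^'+, `|a - f t| < d.
  move=> fl <- d0.
  have := cvg_trans (cvg_app _ (at_right_steps (lexx 0))) (path_deriv_cvg fl).
  by move=> /cvgrPdist_lt/(_ _ d0); apply: filterS => t; rewrite add0r.
have q0 : 0 < 4^-1 :> R[i] by rewrite invr_gt0 ltr0n.
near=> t => z z1.
have c1 : `|1 - ccosh m t| < 4^-1.
  by near: t; exact: to0 (@ccosh_deriv _ m 0) (ccosh0 m) q0.
have s1 : `|csinhc m t| * k < 4^-1.
  rewrite -ltr_pdivlMr// -normrN -sub0r; near: t.
  by apply: to0 (@csinhc_deriv _ m 0) (csinhc0 m) _; rewrite divr_gt0.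
have s2 : `|csinhc m t| * k < e / 2.
  rewrite -ltr_pdivlMr// -normrN -sub0r; near: t.
  by apply: to0 (@csinhc_deriv _ m 0) (csinhc0 m) _; rewrite !divr_gt0.
have d1 : `|1 - fden t z 1| <= 2^-1.
  have -> : 1 - fden t z 1 =
      (1 - ccosh m t) + csinhc m t * (alpha * z + beta / 2).
    by rewrite /flow_den -/m !mulr1; ring.
  apply: le_trans (ler_normD _ _) _.
  have half : 2^-1 = 4^-1 + 4^-1 :> R[i] by field.
  rewrite [leRHS]half.
  apply: lerD; first exact: ltW.
  apply: le_trans (ltW s1); rewrite normrM ler_wpM2l//.
  apply: le_trans (ler_normD _ _) _.
  have -> : k = (`|alpha| + `|beta|) + (1 + `|gamma|) by rewrite /k; ring.
  apply: ler_wpDr; first exact: addr_ge0.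
  apply: lerD; rewrite normrM ler_piMr//.
  by rewrite normfV ger0_norm ?ler0n// invf_le1 ?ler1n// ltr0n.
have d2 : 2^-1 <= `|fden t z 1|.
  have h : 1 <= 2^-1 + `|fden t z 1|.
    rewrite -{1}(normr1 R[i]) -{1}(subrK (fden t z 1) 1).
    by apply: le_trans (ler_normD _ _) _; rewrite lerD2r.
  rewrite -lerBlDl in h; apply: le_trans h; rewrite le_eqVlt; apply/orP; left.
  by apply/eqP; field.
have d0 : 0 < `|fden t z 1| by apply: lt_le_trans d2; rewrite invr_gt0 ltr0n.
rewrite -normrN opprB flow_subE; last by rewrite -normr_gt0.
rewrite normrM normfV ltr_pdivrMr//.
apply: (@le_lt_trans _ _ (`|csinhc m t| * k)); last first.
  by apply: lt_le_trans s2 _; rewrite ler_wpM2l// ltW.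
rewrite normrM ler_wpM2l//.
apply: le_trans (ler_normD _ _) _; apply: lerD => //.
apply: le_trans (ler_normD _ _) _; apply: lerD => //; last first.
  by rewrite normrM ler_piMr.
rewrite normrM normrX; apply: ler_wpDl => //; apply: ler_piMr => //.
by rewrite exprn_ile1.
Unshelve. all: by end_near. Qed.

Section Dissipative.
Hypothesis dissip : 'Re beta + `|alpha + gamma^*| <= 0.

Lemma flow_contracts t x y :
  0 <= t -> `|x| < `|y| -> `|fnum t x y| < `|fden t x y|.
Proof.
move=> t0 xy; rewrite -energy_lt0.
apply: le_lt_trans (flow_energy_le _ _ dissip t0) _.
by rewrite energy_lt0.
Qed.

Lemma flow_den_neq0 t z : 0 <= t -> `|z| < 1 -> fden t z 1 != 0.
Proof.
move=> t0 z1; have := @flow_contracts t z 1 t0; rewrite normr1 => /(_ z1).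
by rewrite -normr_gt0; apply: le_lt_trans.
Qed.

Lemma flow_disc t z : 0 <= t -> `|z| < 1 -> `|phi t z| < 1.
Proof.
move=> t0 z1; have := @flow_contracts t z 1 t0; rewrite normr1 => /(_ z1).
rewrite /flow normrM normfV ltr_pdivrMr ?mul1r// normr_gt0; exact: flow_den_neq0.
Qed.

Lemma flow_self_map t : 0 <= t -> holomorphic_self_map (phi t : C -> C).
Proof.
move=> t0; split=> [z z1|z z1]; last exact: flow_disc.
by apply: flow_derivable; apply: flow_den_neq0.
Qed.

Lemma flow_semigroup : semigroup (phi : R -> C -> C).
Proof.
split=> [t|z z1|t s z t0 s0 z1|].
- exact: flow_self_map.
- exact: flow0.
- exact/flowD/flow_den_neq0.
- apply/fam_cvgP => A [subA _] P /uniform_nbhs [E [+ EP]].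
  rewrite -entourage_from_ballE => -[e /= e0 eE].
  have := flow_near_id e0; rewrite !near_simpl/=; apply: filterS => t H.
  apply: EP => z Az; apply: eE => /=; apply: H.
  exact: ltW (subA _ Az).
Qed.

Lemma flow_generator (G : C -> C) : holomorphic_on_disc G ->
  (forall z : C, unit_disc z -> G z = alpha * z ^+ 2 + beta * z + gamma) ->
  generator_of (phi : R -> C -> C) G.
Proof.
move=> hG Gp; split=> // z t z1 t0; rewrite Gp; last exact: flow_disc.
by apply: flow_deriv; exact: flow_den_neq0.
Qed.
End Dissipative.
End FlowSemigroup.

(** * Uniqueness of orbits *)

Section Uniqueness.
Variable R : realType.
Local Notation C := (R[i]^o).

(** A Gronwall argument: |w|^2 exp(-kt) does not increase, because its derivative
    is (2 Re c - k) |w|^2 exp(-kt). *)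
Lemma linear_ode_eq0 (w c : R -> C) (k : R) :
  (forall t : R, 0 <= t -> path_deriv w t (c t * w t)) ->
  (forall t : R, 0 <= t -> 2 * `|c t| <= k%:C%C) ->
  w 0 = 0 -> forall t, 0 <= t -> w t = 0.
Proof.
move=> dw ck w0 t t0.
pose e (s : R) : C := (expR (- k * s))%:C%C.
have e0 s : 0 < e s by rewrite ltcR expR_gt0.
have de s : path_deriv e s (- k%:C%C * e s).
  have d : is_derive s 1 (fun s : R => expR (- k * s)) (- k * expR (- k * s)).
    by apply: is_derive_eq; rewrite [_%:A]mulr1 [LHS]mulrC.
  by have := real_path_deriv d; rewrite rmorphM rmorphN.
have key (K : numClosedFieldType) (x v q r : K) :
    ((x * v) * v^* + v * (x * v)^*) * r + v * v^* * (- q * r) =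
    (2 * 'Re x - q) * (`|v| ^+ 2 * r).
  by rewrite ReE normCK rmorphM /=; field.
have rl s : ((c s * w s) * (w s)^* + w s * (c s * w s)^*) * e s +
      w s * (w s)^* * (- k%:C%C * e s) =
    (2 * 'Re (c s) - k%:C%C) * (`|w s| ^+ 2 * e s) := key _ _ _ _ _.
have dg s : 0 <= s -> path_deriv (fun s => w s * (w s)^* * e s : C) s
    ((2 * 'Re (c s) - k%:C%C) * (`|w s| ^+ 2 * e s) : C).
  move=> s0; rewrite -rl; have d := dw s s0.
  exact: (path_derivM (path_derivM d (path_deriv_conj d)) (de s)).
have H s : 0 <= s -> (2 * 'Re (c s) - k%:C%C) * (`|w s| ^+ 2 * e s) <= 0.
  move=> s0; apply: mulr_le0_ge0; last by rewrite mulr_ge0 ?exprn_ge0// ltW.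
  rewrite subr_le0; apply: le_trans (ck s s0); rewrite ler_pM2l ?ltr0n//.
  exact: Re_le_norm.
have HR s : 0 <= s ->
    'Re ((2 * 'Re (c s) - k%:C%C) * (`|w s| ^+ 2 * e s)) <= 0.
  by move=> s0; rewrite (Creal_ReP _ _) ?ler0_real ?H.
have := path_Re_nonincreasing dg HR t0; rewrite w0 !mul0r raddf0 -normCK.
rewrite (Creal_ReP _ _); last by rewrite ger0_real// mulr_ge0 ?exprn_ge0// ltW.
rewrite pmulr_lle0// => h; apply/eqP.
by rewrite -normr_eq0 -sqrf_eq0 eq_le h exprn_ge0.
Qed.

(** With (n, d) = exp(tM) (f 0, 1) and f any solution, w = n - f d satisfies the
    linear equation w' = (beta/2 + alpha f) w and w(0) = 0, so n = f d.  Since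
    exp(tM) is invertible, d = 0 would force n = 0 as well. *)
Lemma orbit_is_flow (alpha beta gamma : R[i]) (f : R -> C) :
  (forall t : R, 0 <= t -> `|f t| <= 1) ->
  (forall t : R, 0 <= t ->
     path_deriv f t (alpha * f t ^+ 2 + beta * f t + gamma : C)) ->
  forall t : R, 0 <= t -> flow_den alpha beta gamma t (f 0) 1 != 0 /\
    f t = flow alpha beta gamma t (f 0).
Proof.
move=> f1 df.
pose n t : C := flow_num alpha beta gamma t (f 0) 1.
pose d t : C := flow_den alpha beta gamma t (f 0) 1.
have key (K : fieldType) (a b' c x u v : K) :
  (b' * u + c * v) -
    ((a * x ^+ 2 + (b' + b') * x + c) * v + x * (- (a * u + b' * v))) =
  (b' + a * x) * (u - x * v) by ring.
pose w t : C := n t - f t * d t.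
have dw t : 0 <= t -> path_deriv w t ((beta / 2 + alpha * f t) * w t).
  move=> t0; have dn := @flow_num_deriv _ alpha beta gamma t (f 0) 1.
  have dd := @flow_den_deriv _ alpha beta gamma t (f 0) 1.
  apply: path_deriv_eq (path_derivB dn (path_derivM (df t t0) dd)) _.
  by rewrite -(key _ _ _ gamma) -splitr.
pose k : R := complex.Re (`|beta| + 2 * `|alpha|).
have kE : k%:C%C = `|beta| + 2 * `|alpha|.
  by rewrite /k RRe_real// ger0_real// addr_ge0// mulr_ge0.
have w0 t : 0 <= t -> w t = 0.
  apply: (linear_ode_eq0 (k := k) dw) => [s s0|]; last first.
    by rewrite /w /n /d flow_num0 flow_den0 mulr1 subrr.
  rewrite kE; apply: (@le_trans _ _ (2 * (`|beta / 2| + `|alpha| * 1))).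
    rewrite ler_pM2l ?ltr0n//; apply: le_trans (ler_normD _ _) _.
    by rewrite lerD2l normrM ler_wpM2l// f1.
  rewrite mulr1 mulrDr normrM normfV normr_nat [2 * (_ / _)]mulrC.
  by rewrite divfK// pnatr_eq0.
move=> t t0; have nfd : n t = f t * d t.
  by apply: subr0_eq; exact: w0.
have d0 : d t != 0.
  apply/eqP => d0; have n0 : n t = 0 by rewrite nfd d0 mulr0.
  by have [_ /eqP] := flow_eq0 n0 d0; rewrite oner_eq0.
by split=> //; rewrite /flow -/(n t) -/(d t) nfd mulfK.
Qed.
End Uniqueness.

(** * Semigroups with a quadratic generator *)

Section GeneratorsAreDissipative.
Variable R : realType.
Local Notation C := (R[i]^o).
Variables alpha beta gamma : R[i].
Local Notation fnum := (flow_num alpha beta gamma).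
Local Notation fden := (flow_den alpha beta gamma).
Variables (G : C -> C) (phi : R -> C -> C).
Hypothesis quadG : forall z : C, unit_disc z ->
  G z = alpha * z ^+ 2 + beta * z + gamma.
Hypothesis sg : semigroup phi.
Hypothesis genG : generator_of phi G.

Lemma semigroup_is_flow (t : R) (z : C) : 0 <= t -> unit_disc z ->
  fden t z 1 != 0 /\ phi t z = flow alpha beta gamma t z.
Proof.
move=> t0 z1; have [self id0 _ _] := sg.
have disc s : 0 <= s -> unit_disc (phi s z).
  by move=> s0; have [_ ] := self s s0; apply.
have := @orbit_is_flow _ alpha beta gamma (fun s => phi s z) _ _ t t0.
rewrite (id0 _ z1); apply=> s s0; first exact: ltW (disc s s0).
by rewrite -(quadG (disc s s0)); apply: genG.2.
Qed.

Lemma semigroup_num_lt_den (t : R) (z : C) : 0 <= t -> unit_disc z ->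
  `|fnum t z 1| < `|fden t z 1|.
Proof.
move=> t0 z1; have [d0 E] := semigroup_is_flow t0 z1.
have [self _ _ _] := sg; have [_ /(_ _ z1)] := self t t0.
rewrite /unit_disc/= E /flow => H; move: (H : `|fnum t z 1 / fden t z 1| < 1).
by rewrite normrM normfV ltr_pdivrMr ?mul1r// normr_gt0.
Qed.

(** The strict inequality at the points (1 - r) z of the disc, for r small. *)
Lemma semigroup_num_le_den (t : R) (z : R[i]) : 0 <= t -> `|z| <= 1 ->
  `|fnum t z 1| <= `|fden t z 1|.
Proof.
move=> t0 z1; apply/ler_addgt0Pr => e e0.
pose A := `|fnum t 1 0| + `|fden t 1 0|.
have A0 : 0 <= A by exact: addr_ge0.
have s0 : 0 < e + A + 1 by rewrite ltr_wpDl// addr_ge0// ltW.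
pose r := e / (e + A + 1).
have r0 : 0 < r by exact: divr_gt0.
have r1 : r < 1 by rewrite ltr_pdivrMr// mul1r -addrA ltrDl ltr_wpDl.
have rA : r * A <= e.
  rewrite /r mulrAC ler_pdivrMr// ler_wpM2l ?ltW//.
  by rewrite -addrA ltr_wpDl// ?ltW// ltrDl.
clearbody r.
have zd : `|(1 - r) * z| < 1.
  rewrite normrM ger0_norm ?subr_ge0 ?ltW//.
  apply: (@le_lt_trans _ _ (1 - r)); last by rewrite ltrBlDr ltrDl.
  by rewrite ler_piMr// subr_ge0 ltW.
have := semigroup_num_lt_den t0 (zd : unit_disc ((1 - r) * z : C)).
have split_lin (a b : R[i]) :
  (1 - r) * z * a + 1 * b = (z * a + 1 * b) - r * z * a by ring.
rewrite flow_num_lin flow_den_lin !split_lin -!flow_num_lin -!flow_den_lin => H.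
have rz a : `|r * z * a| <= r * `|a|.
  by rewrite !normrM (gtr0_norm r0) -mulrA ler_wpM2l ?(ltW r0)// ler_piMl.
rewrite -(subrK (r * z * fnum t 1 0) (fnum t z 1)).
apply: le_trans (ler_normD _ _) _.
apply: (@le_trans _ _ (`|fden t z 1| + r * A)); last by rewrite lerD2l.
apply: le_trans (lerD (ltW H) (rz _)) _.
apply: le_trans (lerD (ler_normB _ _) (lexx _)) _.
by rewrite /A [r * (_ + _)]mulrDr [leRHS]addrA [leRHS]addrAC lerD2r lerD2l.
Qed.

(** On the circle the form |n|^2 - |d|^2 starts at 0 and stays nonpositive, so its
    derivative at t = 0 is nonpositive. *)
Lemma circle_rate_le0 (z : R[i]) : `|z| = 1 ->
  'Re beta + 'Re ((alpha + gamma^*) * z) <= 0.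
Proof.
move=> z1.
have := path_deriv0_Re_le0 (@flow_energy_deriv _ alpha beta gamma 0 z 1).
rewrite flow_num0 flow_den0 => H.
have {}H : 'Re (energy_rate alpha beta gamma z 1) <= 0.
  apply: H => t t0; rewrite !Re_energy z1 normr1 subrr.
  by rewrite energy_le0 semigroup_num_le_den// z1.
by move: H; rewrite Re_energy_rate_circle// pmulr_rle0// ltr0n.
Qed.

Lemma generator_dissipative : 'Re beta + `|alpha + gamma^*| <= 0.
Proof. exact/Re_circle_le0/circle_rate_le0. Qed.

(** If |c| >= |d|, then cz + d vanishes at a point of the closed disc, where by
    [semigroup_num_le_den] the numerator vanishes too; but exp(tM) is
    invertible. *)
Lemma semigroup_linear_fractional (t : R) :
  0 <= t -> linear_fractional_self_map (phi t).
Proof.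
move=> t0; have fE z : unit_disc z -> phi t z = fnum t z 1 / fden t z 1.
  by move=> z1; have [_ ->] := semigroup_is_flow t0 z1.
have d10 z : unit_disc z -> fden t z 1 != 0.
  by move=> z1; have [] := semigroup_is_flow t0 z1.
have [disc0 disch _] := unit_disc_samples R.
split; last by have [/(_ t t0)[]] := sg.
- exists (fnum t 1 0), (fnum t 0 1), (fden t 1 0), (fden t 0 1).
  split; last first.
    move=> z z1; rewrite fE// flow_num_lin flow_den_lin !mul1r.
    by rewrite [z * fnum _ _ _]mulrC [z * fden _ _ _]mulrC.
  have dn0 := d10 _ disc0.
  case: (real_ltP (normr_real (fden t 1 0)) (normr_real (fden t 0 1))) => // dc.
  have c0 : fden t 1 0 != 0.
    by rewrite -normr_gt0; apply: lt_le_trans dc; rewrite normr_gt0.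
  pose z := - fden t 0 1 / fden t 1 0.
  have dz : fden t z 1 = 0.
    by rewrite flow_den_lin /z divfK// mul1r addNr.
  have := @semigroup_num_le_den t z t0.
  rewrite dz normr0 normr_le0 /z normrM normfV normrN.
  rewrite ler_pdivrMr ?normr_gt0// mul1r.
  move=> /(_ dc)/eqP nz; have [_ /eqP] := flow_eq0 nz dz.
  by rewrite oner_eq0.
(* Were the ratio constantly w, the range of exp(tM) would lie on a line; it
   contains (w + 1, 1). *)
- move=> [w wE].
  have n01 : fnum t 0 1 = w * fden t 0 1 by rewrite -(wE _ disc0) fE// divfK ?d10.
  have : fnum t 2^-1 1 = w * fden t 2^-1 1.
    by rewrite -(wE _ disch) fE// divfK ?d10.
  rewrite flow_num_lin flow_den_lin !mul1r [w * (_ + _)]mulrDr n01 => /addIr.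
  rewrite mulrCA => /(mulfI _); rewrite invr_eq0 pnatr_eq0 => /(_ isT) n10.
  have nw x y : fnum t x y = w * fden t x y.
    by rewrite flow_num_lin [fden t x y]flow_den_lin n01 n10; ring.
  have x1 : fnum t (fnum (- t) (w + 1) 1) (fden (- t) (w + 1) 1) = w + 1.
    by have := flow_numK alpha beta gamma (- t) (w + 1) 1; rewrite opprK.
  have y1 : fden t (fnum (- t) (w + 1) 1) (fden (- t) (w + 1) 1) = 1.
    by have := flow_denK alpha beta gamma (- t) (w + 1) 1; rewrite opprK.
  have := nw (fnum (- t) (w + 1) 1) (fden (- t) (w + 1) 1).
  rewrite x1 y1 mulr1 => /eqP; rewrite -subr_eq0 addrAC subrr add0r.
  by rewrite oner_eq0.
Qed.

(** If |n| < |d| at a point z of the circle, then n/d lies in the disc and is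
    phi_t(v) for some v in the disc; the Moebius map being injective, z = v. *)
Lemma automorphic_num_eq_den (t : R) (z : R[i]) :
  automorphism (phi t) -> 0 <= t -> `|z| = 1 -> `|fnum t z 1| = `|fden t z 1|.
Proof.
move=> [_ [g [_ gdisc] gK]] t0 z1; apply/eqP.
rewrite eq_le semigroup_num_le_den ?z1//=.
rewrite real_leNgt ?normr_real//; apply/negP => lt.
have d0 : fden t z 1 != 0 by rewrite -normr_gt0; apply: le_lt_trans lt.
have w1 : unit_disc (flow alpha beta gamma t z : C).
  by rewrite /unit_disc/= /flow normrM normfV ltr_pdivrMr ?mul1r// normr_gt0.
have [_ gw] := gK _ w1; have v1 := gdisc _ w1.
have [dv pv] := semigroup_is_flow t0 v1.
have vz : g (flow alpha beta gamma t z) = z.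
  by rewrite -(flowK dv) -pv gw flowK.
by move: v1; rewrite /unit_disc/= vz z1 ltxx.
Qed.

Lemma automorphic_circle_rate_eq0 (z : R[i]) :
  (forall t : R, 0 <= t -> automorphism (phi t)) -> `|z| = 1 ->
  'Re beta + 'Re ((alpha + gamma^*) * z) = 0.
Proof.
move=> aut z1; apply/eqP; rewrite eq_le circle_rate_le0//=.
have E (t : R) : 0 <= t -> energy (fnum t z 1) (fden t z 1) = 0.
  by move=> t0; rewrite energyE automorphic_num_eq_den ?subrr//; exact: aut.
have := path_deriv0_Re_le0 (path_derivB (path_deriv_cst (0 : C) 0)
  (@flow_energy_deriv _ alpha beta gamma 0 z 1)).
rewrite flow_num0 flow_den0 [0 - energy_rate _ _ _ _ _]sub0r.
rewrite raddfN /= oppr_le0 Re_energy_rate_circle// pmulr_rge0 ?ltr0n//.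
apply=> t t0.
by rewrite E// energyE z1 normr1 !subrr.
Qed.
End GeneratorsAreDissipative.

(** * Generators of linear fractional semigroups are quadratic *)

Section LinearFractionalGenerators.
Variable R : realType.
Local Notation C := (R[i]^o).

(** The equation between the cross-ratios of (y1, y2, y3, y4) and of
    (x1, x2, x3, x4), cleared of denominators: it stays polynomial in the yi,
    so that it can be differentiated by the product rule. *)
Definition cross_defect (K : fieldType) (x1 x2 x3 x4 y1 y2 y3 y4 : K) : K :=
  (y1 - y3) * (y2 - y4) * ((x1 - x4) * (x2 - x3)) -
  (y1 - y4) * (y2 - y3) * ((x1 - x3) * (x2 - x4)).

(** The derivative of [cross_defect] when each yi moves with velocity gi. *)
Definition cross_defect_rate (K : fieldType)
    (x1 x2 x3 x4 y1 y2 y3 y4 g1 g2 g3 g4 : K) : K :=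
  ((g1 - g3) * (y2 - y4) + (y1 - y3) * (g2 - g4)) * ((x1 - x4) * (x2 - x3)) -
  ((g1 - g4) * (y2 - y3) + (y1 - y4) * (g2 - g3)) * ((x1 - x3) * (x2 - x4)).

(** At y = x the rate is linear in the velocities and vanishes on quadratic
    fields, which are the infinitesimal Moebius maps; so it determines g1 as the
    Lagrange interpolation polynomial of (0, g2), (p, g3), (-p, g4) at z. *)
Lemma lagrange_of_cross_defect_rate (K : numFieldType) (z g1 g2 g3 g4 : K) :
  let p := 2^-1 in
  cross_defect_rate z 0 p (- p) z 0 p (- p) g1 g2 g3 g4 = 0 ->
  g1 = 2 * (g3 + g4 - 2 * g2) * z ^+ 2 + (g3 - g4) * z + g2.
Proof.
move=> p E; apply/eqP; rewrite -subr_eq0; apply/eqP.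
by rewrite -[RHS](mulr0 (- 4)) -E /cross_defect_rate /p; field.
Qed.

Lemma cross_defect_deriv (x1 x2 x3 x4 : C) (f1 f2 f3 f4 : R -> C) t
    (g1 g2 g3 g4 : C) :
  path_deriv f1 t g1 -> path_deriv f2 t g2 ->
  path_deriv f3 t g3 -> path_deriv f4 t g4 ->
  path_deriv
    (fun t => cross_defect x1 x2 x3 x4 (f1 t) (f2 t) (f3 t) (f4 t) : C) t
    (cross_defect_rate x1 x2 x3 x4 (f1 t) (f2 t) (f3 t) (f4 t) g1 g2 g3 g4 : C).
Proof.
move=> d1 d2 d3 d4.
have dL := path_derivM (path_derivM (path_derivB d1 d3) (path_derivB d2 d4))
  (path_deriv_cst ((x1 - x4) * (x2 - x3) : C) t).
have dR := path_derivM (path_derivM (path_derivB d1 d4) (path_derivB d2 d3))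
  (path_deriv_cst ((x1 - x3) * (x2 - x4) : C) t).
by apply: path_deriv_eq (path_derivB dL dR) _; rewrite !mulr0 !addr0.
Qed.

Lemma mobius_cross_defect (K : fieldType) (a b c d x1 x2 x3 x4 : K) :
  c * x1 + d != 0 -> c * x2 + d != 0 -> c * x3 + d != 0 -> c * x4 + d != 0 ->
  cross_defect x1 x2 x3 x4 ((a * x1 + b) / (c * x1 + d))
    ((a * x2 + b) / (c * x2 + d)) ((a * x3 + b) / (c * x3 + d))
    ((a * x4 + b) / (c * x4 + d)) = 0.
Proof.
by move=> e1 e2 e3 e4; rewrite /cross_defect; field; rewrite e1 e2 e3 e4.
Qed.

Lemma cross_defect_eq0 (f : C -> C) (x1 x2 x3 x4 : C) :
  linear_fractional_self_map f ->
  unit_disc x1 -> unit_disc x2 -> unit_disc x3 -> unit_disc x4 ->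
  cross_defect x1 x2 x3 x4 (f x1) (f x2) (f x3) (f x4) = 0 :> R[i].
Proof.
move=> [[a [b [c [d [cd fE]]]]] _ _] h1 h2 h3 h4; rewrite !fE//.
have den0 (x : R[i]) : `|x| < 1 -> c * x + d != 0.
  move=> x1'; apply/eqP => /eqP; rewrite addr_eq0 => /eqP E.
  have : `|c * x| < `|d|.
    by rewrite normrM; apply: le_lt_trans cd; rewrite ler_piMr// ltW.
  by rewrite E normrN ltxx.
have {h1}d1 := den0 _ h1; have {h2}d2 := den0 _ h2.
have {h3}d3 := den0 _ h3; have {h4}d4 := den0 _ h4.
exact: (mobius_cross_defect _ _ d1 d2 d3 d4).
Qed.

(** The cross-ratio of the images of 0, 1/2, -1/2 and z is constant in t. *)
Lemma lft_generator_quadratic (G : C -> C) : generates_lft_semigroup G ->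
  exists alpha beta gamma : R[i],
    forall z : C, unit_disc z -> G z = alpha * z ^+ 2 + beta * z + gamma.
Proof.
move=> [phi [[_ id0 _ _] lft [_ gen]]].
have dphi (z : C) : unit_disc z -> path_deriv (fun t => phi t z) 0 (G z).
  move=> z1.
  apply: (path_deriv_eq (f := fun t => phi t z) (gen z 0 z1 (lexx _))).
  by rewrite id0.
have [disc0 disch dischN] := unit_disc_samples R.
exists (2 * (G 2^-1 + G (- 2^-1) - 2 * G 0)), (G 2^-1 - G (- 2^-1)), (G 0).
move=> z z1.
apply: lagrange_of_cross_defect_rate.
have := @cross_defect_deriv z 0 2^-1 (- 2^-1) _ _ _ _ _ _ _ _ _
  (dphi _ z1) (dphi _ disc0) (dphi _ disch) (dphi _ dischN).
rewrite !id0//; apply: path_deriv_vanishing => t t0.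
exact: cross_defect_eq0 (lft t t0) _ _ _ _.
Qed.
End LinearFractionalGenerators.

(** * Quadratic polynomials *)

Section QuadraticPolynomials.
Variable R : realType.
Local Notation C := (R[i]^o).
Implicit Types (alpha beta gamma : R[i]) (G : C -> C).

Lemma quadratic_samples_unique (K : numFieldType) (a b c a' b' c' : K) :
  let q z := a * z ^+ 2 + b * z + c in
  let q' z := a' * z ^+ 2 + b' * z + c' in
  q 0 = q' 0 -> q 2^-1 = q' 2^-1 -> q (- 2^-1) = q' (- 2^-1) ->
  [/\ a = a', b = b' & c = c'].
Proof.
move=> q q'; have d (x y : K) : x = y -> x - y = 0 by move->; rewrite subrr.
move=> /d e0 /d ep /d en; split; apply: subr0_eq.
- transitivity (2 * ((q 2^-1 - q' 2^-1) + (q (- 2^-1) - q' (- 2^-1)) -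
    2 * (q 0 - q' 0))); first by rewrite /q /q'; field.
  by rewrite e0 ep en mulr0 subr0 addr0 mulr0.
- transitivity ((q 2^-1 - q' 2^-1) - (q (- 2^-1) - q' (- 2^-1))).
    by rewrite /q /q'; field.
  by rewrite ep en subr0.
- by rewrite -[RHS]e0 /q /q'; ring.
Qed.

Lemma quadratic_disc_unique (a b c a' b' c' : R[i]) :
  (forall z : C, unit_disc z ->
    a * z ^+ 2 + b * z + c = a' * z ^+ 2 + b' * z + c') ->
  [/\ a = a', b = b' & c = c'].
Proof.
move=> H.
have h0 := H 0; have hp := H 2^-1; have hn := H (- 2^-1).
have [disc0 disch dischN] := unit_disc_samples R.
exact: quadratic_samples_unique (h0 disc0) (hp disch) (hn dischN).
Qed.

Lemma horner_size3 (p : {poly R[i]}) z : (size p <= 3)%N ->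
  p.[z] = p`_2 * z ^+ 2 + p`_1 * z + p`_0.
Proof.
move=> sp; rewrite (horner_coef_wide _ sp) !big_ord_recr big_ord0 /=.
by rewrite add0r expr0 expr1 mulr1; ring.
Qed.

Lemma quadratic_is_poly2 alpha beta gamma G :
  (forall z : C, unit_disc z -> G z = alpha * z ^+ 2 + beta * z + gamma) ->
  is_poly2 G (Poly [:: gamma; beta; alpha]).
Proof.
move=> H; split=> [|z z1]; first exact: size_Poly.
by rewrite H// horner_Poly /= mul0r add0r; ring.
Qed.

End QuadraticPolynomials.

(** * Passing between the coefficient conditions *)

Section Equivalences.
Variable R : realType.
Local Notation C := (R[i]^o).
Implicit Types (alpha beta gamma a m n : R[i]) (G : C -> C).

Lemma boundary_form_coef G (p : {poly R[i]}) :
  boundary_form G p -> coef_form G p`_2 p`_1 p`_0.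
Proof.
move=> [[sp Gp] bnd]; split=> [z z1|]; first by rewrite Gp// horner_size3.
apply/Re_circle_le0 => z z1; rewrite -boundary_Re// -horner_size3//.
exact: bnd.
Qed.

Lemma coef_form_boundary G alpha beta gamma :
  coef_form G alpha beta gamma -> boundary_form G (Poly [:: gamma; beta; alpha]).
Proof.
move=> [Gq H]; split; first exact: quadratic_is_poly2.
move=> z z1.
have -> : (Poly [:: gamma; beta; alpha]).[z] =
    alpha * z ^+ 2 + beta * z + gamma.
  by rewrite horner_Poly /= mul0r add0r; ring.
by rewrite boundary_Re//; move: z z1; apply/Re_circle_le0.
Qed.

Lemma coef_form_amn G alpha beta gamma : coef_form G alpha beta gamma ->
  amn_form G gamma (- (alpha + gamma^*)) (- beta).
Proof.
move=> [Gq H]; split=> [z z1|]; first by rewrite Gq//; ring.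
by rewrite normrN raddfN /= -subr_ge0 -opprD oppr_ge0.
Qed.

Lemma amn_form_coef G a m n : amn_form G a m n -> coef_form G (- a^* - m) (- n) a.
Proof.
move=> [Gq H]; split=> [z z1|]; first by rewrite Gq//; ring.
by rewrite addrAC addNr add0r normrN raddfN /= addrC subr_le0.
Qed.

(** Here the form |n|^2 - |d|^2 is conserved, so the flow at time -t preserves the
    disc as well, and it inverts the flow at time t. *)
Lemma coef_form_automorphisms G alpha beta gamma : holomorphic_on_disc G ->
  coef_form G alpha beta gamma -> 'Re beta = 0 -> `|alpha + gamma^*| = 0 ->
  generates_automorphism_semigroup G.
Proof.
move=> hG [Gq H] b0 k0; exists (flow alpha beta gamma : R -> C -> C).
split; [exact: flow_semigroup | | exact: flow_generator].
have rate0 n d : 'Re (energy_rate alpha beta gamma n d) = 0.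
  by rewrite Re_energy_rate b0 (normr0_eq0 k0) !mul0r raddf0 mulr0 addr0.
move=> t t0; have back z : `|z| < 1 -> flow_den alpha beta gamma (- t) z 1 != 0 /\
    `|flow alpha beta gamma (- t) z| < 1.
  (* conservation from time 0 to time t, applied to exp(-tM) (z, 1) *)
  move=> z1; pose n' := flow_num alpha beta gamma (- t) z 1.
  pose d' := flow_den alpha beta gamma (- t) z 1.
  have := flow_energy_eq n' d' rate0 t0.
  have En : flow_num alpha beta gamma t n' d' = z.
    by have := flow_numK alpha beta gamma (- t) z 1; rewrite opprK.
  have Ed : flow_den alpha beta gamma t n' d' = 1.
    by have := flow_denK alpha beta gamma (- t) z 1; rewrite opprK.
  rewrite En Ed => E.
  have nd : `|n'| < `|d'| by rewrite -energy_lt0 -E energy_lt0 normr1.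
  have d0 : 0 < `|d'| by apply: le_lt_trans nd.
  split; first by rewrite -normr_gt0.
  by rewrite /flow normrM normfV ltr_pdivrMr ?mul1r.
split; first exact: flow_self_map.
exists (flow alpha beta gamma (- t)).
  split=> z z1; last by have [] := back z z1.
  by apply: flow_derivable; have [] := back z z1.
move=> z z1; split; first by apply: flowK; exact: flow_den_neq0.
have [d0 _] := back z z1.
by have := flowK d0; rewrite opprK.
Qed.
End Equivalences.

(** * Characterization of quadratic generators *)

Theorem theorem2p3 (R : realType) (G : R[i]^o -> R[i]^o)
    (hG : holomorphic_on_disc G) :
  [<-> generates_lft_semigroup G;
       exists p : {poly R[i]}, boundary_form G p;
       exists alpha beta gamma : R[i], coef_form G alpha beta gamma;
       exists a m n : R[i], amn_form G a m n;
       generates_semigroup G /\ exists p : {poly R[i]}, is_poly2 G p] /\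
  (forall (p : {poly R[i]}) (alpha beta gamma a m n : R[i]),
     boundary_form G p -> coef_form G alpha beta gamma -> amn_form G a m n ->
     [<-> 'Re n = 0 /\ m = 0;
          'Re beta = 0 /\ `|alpha + gamma^* | = 0;
          forall z : R[i], unit_circle z -> 'Re (p.[z] * z^* ) = 0;
          generates_automorphism_semigroup G]).
Proof.
split.
  tfae.
  - move=> lftG.
    have [alpha [beta [gamma quadG]]] := lft_generator_quadratic lftG.
    have [phi [sg _ gen]] := lftG.
    exists (Poly [:: gamma; beta; alpha]); apply: coef_form_boundary; split=> //.
    exact: generator_dissipative quadG sg gen.
  - by move=> [p /boundary_form_coef]; exists p`_2, p`_1, p`_0.
  - by move=> [alpha [beta [gamma /coef_form_amn]]]; do 3 eexists; eassumption.
  - move=> [a [m [n /amn_form_coef [quadG dissip]]]]; split; last first.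
      by eexists; exact: quadratic_is_poly2 quadG.
    exists (flow (- a^* - m) (- n) a); first exact: flow_semigroup.
    exact: flow_generator.
  - move=> [[phi sg gen] [p [sp Gp]]].
    have quadG z : unit_disc z -> G z = p`_2 * z ^+ 2 + p`_1 * z + p`_0.
      by move=> z1; rewrite Gp// horner_size3.
    exists phi; split=> // t t0.
    exact: semigroup_linear_fractional quadG sg gen t t0.
move=> p alpha beta gamma a m n bnd coef amn.
have [quadG dissip] := coef.
have [[sp Gp] _] := bnd; have [Ga _] := amn_form_coef amn.
have [aE bE cE] : [/\ alpha = - a^* - m, beta = - n & gamma = a].
  by apply: quadratic_disc_unique => z z1; rewrite -quadG// Ga.
have [c2 c1 c0] : [/\ p`_2 = alpha, p`_1 = beta & p`_0 = gamma].
  by apply: quadratic_disc_unique => z z1; rewrite -quadG// Gp// horner_size3.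
have kE : alpha + gamma^* = - m by rewrite aE cE addrAC addNr add0r.
tfae.
- by move=> [n0 m0]; rewrite kE bE m0 raddfN /= n0 !oppr0 normr0.
- move=> bk z z1; rewrite horner_size3// c2 c1 c0 boundary_Re//.
  by move: z z1; apply/Re_circle_eq0.
- move=> H; have [b0 k0] : 'Re beta = 0 /\ `|alpha + gamma^*| = 0.
    apply/Re_circle_eq0 => z z1.
    by rewrite -boundary_Re// -c2 -c1 -c0 -horner_size3//; exact: H.
  exact: coef_form_automorphisms coef b0 k0.
- move=> [phi [sg aut gen]].
  have [] : 'Re beta = 0 /\ `|alpha + gamma^*| = 0.
    apply/Re_circle_eq0 => z.
    exact: automorphic_circle_rate_eq0 quadG sg gen z aut.
  rewrite kE bE raddfN normrN /= => /eqP; rewrite oppr_eq0 => /eqP n0 /eqP.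
  by rewrite normr_eq0 => /eqP.
Qed.
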